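(* Let $c_*=\dfrac{1}{40000000010006048640}$. Whenever $G$ is a finite abelian group with $q(G)>2$, every $A\subseteq G$ with $|A|\ge 2$ and no unique sum satisfies $$|A|\ge c_*\,\log q(G)\,\log\log q(G).$$ In particular, $m(G)\gg\log q(G)\,\log\log q(G)$ uniformly as $q(G)\to\infty$, i.e. there are absolute constants $c>0$ and $q_0$ such that $m(G)\ge c\log q(G)\log\log q(G)$ for every finite abelian group $G$ with $q(G)\ge q_0$.
   Context: All logarithms are natural. For a finite abelian group $G$ with $|G|>1$, $q(G)$ denotes the least prime divisor of $|G|$. A set $A\subseteq G$ has no unique sum if for all $a,b\in A$ there are $c,d\in A$ with $a+b=c+d$ and not ($(a=c$ and $b=d)$ or $(a=d$ and $b=c)$); i.e. no element of $A+A$ has exactly one representation as the sum of an unordered pair (two-element multiset, repetition allowed) of elements of $A$. For a finite abelian group $G$ with $|G|\ge3$, $m(G)$ is the minimum of $|A|$ over all $A\subseteq G$ with $|A|\ge2$ having no unique sum (this minimum exists). *)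

(* Defs.v *)
From mathcomp Require Import all_boot all_order all_algebra.
From mathcomp Require Import all_classical all_reals all_analysis.

Set Implicit Arguments.
Unset Strict Implicit.
Unset Printing Implicit Defensive.

Import Order.TTheory GRing.Theory Num.Theory.

Local Open Scope ring_scope.

Definition no_unique_sum (G : finZmodType) (A : {set G}) : bool :=
  [forall a in A, forall b in A, exists c in A, exists d in A,
     (a + b == c + d) &&
     ~~ ((a == c) && (b == d) || (a == d) && (b == c))].

(* The value is 1 when #|G| = 1. *)
Definition least_pdiv (G : finZmodType) : nat := pdiv #|G|.

Definition admissible (G : finZmodType) (A : {set G}) : bool :=
  (2 <= #|A|)%N && no_unique_sum A.

(* [set: G] is admissible as soon as #|G| >= 3, and the value is then the
   minimum over all admissible sets: see min_nus_attained and min_nus_le. *)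
Definition min_nus (G : finZmodType) : nat :=
  #|[arg min_(A < [set: G] | admissible A) #|A|]|.

Lemma admissible_setT (G : finZmodType) :
  (3 <= #|G|)%N -> admissible [set: G].
Proof.
move=> G3; rewrite /admissible cardsT (ltnW G3) /=.
apply/forall_inP => a _; apply/forall_inP => b _.
have : leq 1 #|~: [set (0 : G); b - a]|.
  rewrite cardsCs finset.setCK subn_gt0 (leq_ltn_trans _ G3) //.
  by rewrite cards2; case: (_ != _).
case/card_gt0P => t; rewrite !inE negb_or => /andP[t0 tba].
apply/exists_inP; exists (a + t); rewrite ?inE //.
apply/exists_inP; exists (b - t); rewrite ?inE //.
rewrite addrACA subrr addr0 eqxx /= negb_or !negb_and.
have -> : (a == a + t) = false.
  by apply/negbTE; rewrite -subr_eq0 opprD addNKr oppr_eq0.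
by rewrite orTb orbC [a + t]addrC -subr_eq eq_sym eq_sym [_ == t]eq_sym tba.
Qed.

Lemma min_nus_attained (G : finZmodType) : (3 <= #|G|)%N ->
  exists2 A : {set G}, admissible A & #|A| = min_nus G.
Proof.
move=> /admissible_setT GT; rewrite /min_nus.
by case: arg_minnP => // A ? _; exists A.
Qed.

Lemma min_nus_le (G : finZmodType) (A : {set G}) : (3 <= #|G|)%N ->
  admissible A -> (min_nus G <= #|A|)%N.
Proof.
move=> /admissible_setT GT Aadm; rewrite /min_nus.
by case: arg_minnP => // B _; apply.
Qed.

(* 1 / 40 000 000 010 006 048 640. The denominator is split into groups of
   digits because numerals of ring_scope are parsed as unary numbers. *)
Definition cstar (R : realType) : R :=
  (40 * 10 ^+ 18 + 10 * 10 ^+ 9 + 6 * 10 ^+ 6 + 48 * 10 ^+ 3 + 640)^-1.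

(* Main.v *)
Require Import Defs.
From mathcomp Require Import all_boot all_order all_algebra.
From mathcomp Require Import all_classical all_reals all_analysis.
From mathcomp Require Import perm fingroup cyclic zify lra.

(* Let q be the least prime divisor of #|G|, and suppose that every element of
   A is a combination of a set D with coefficients of l1-norm at most M.  All
   relations a + b = c + d in A become integer vectors with l1-norm at most 4M
   in dimension #|D|.  Over the rationals these either leave a linear functional
   that is not constant on A, and its maxima form a smaller set with the same
   property, or they force a - a' = 0 up to a nonzero minor, which is at most
   (4M)^#|D|.  Hence (4M)^#|D| >= q as soon as A has no unique sum; the same
   argument gives a unique sum in B + C for any small B and C.

   It remains to find such a D of size O(#|A| / w) with M = O(w).  Call h popular
   if it has many representations as a difference in A, and join elements of A
   whose difference is popular.  A random D of density 1/w contains, for each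
   popular h, some pair x, x + h, so one step along an edge costs 2.  For each a,
   look at the b such that a + b = c + d where neither c nor d is a neighbour
   of a.  If there are many such b, then there are many disjoint triples
   {b, c, d}, and D contains one of them, so that a = c + d - b.  Cover A by few
   balls of radius O(w): a ball of radius w either has more than w elements, or
   contains an a of the previous kind, or is a whole component of size at most w
   all of whose elements have few such b.  There are few components of the last
   type, since any two of them have a unique sum a + b between them, and the
   second representation of a + b in A + A must then avoid one of the two.  With
   w = (log log q)^2 this gives #|A| >> log q * log log q. *)

Set Implicit Arguments.
Unset Strict Implicit.
Unset Printing Implicit Defensive.

Import Order.TTheory GRing.Theory Num.Theory.

Local Open Scope ring_scope.

(** * Bounded integer spans *)

Lemma leq_sum_inj (I J : finType) (h : I -> J) (F : J -> nat) :
  injective h -> (\sum_i F (h i) <= \sum_j F j)%N.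
Proof.
move=> h_inj; rewrite -(big_imset F (h := h) (A := predT)); last by move=> ? ? _ _ /h_inj.
by rewrite [leqRHS](bigID (mem (h @: predT))) /= leq_addr.
Qed.

(** In the Leibniz expansion the sum over permutations is enlarged to all functions; it then factors
    into the product of the row sums. *)
Lemma absz_det_le (n M : nat) (A : 'M[int]_n) :
  (forall i, \sum_j absz (A i j) <= M)%N -> (absz (\det A) <= M ^ n)%N.
Proof.
move=> rowA; have detA : (absz (\det A) <=
    \sum_(s : {perm 'I_n}) \prod_i absz (A i (s i)))%N.
  rewrite -lez_nat abszE; apply: le_trans (ler_norm_sum _ _ _) _.
  rewrite -natz natr_sum; apply: ler_sum => s _.
  rewrite normrM normrX normrN1 expr1n mul1r normr_prod natr_prod.
  by under [leRHS]eq_bigr do rewrite natz abszE.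
apply: leq_trans detA _.
have := leq_sum_inj (h := @pval _)
  (fun f : {ffun 'I_n -> 'I_n} => \prod_i absz (A i (f i)))%N val_inj.
move=> /(leq_trans _) le_ffun; apply: leq_trans (le_ffun _ _) _.
  by apply: leq_sum => s _; apply: leq_prod => i _; rewrite pvalE.
rewrite -(bigA_distr_bigA (fun i j => absz (A i j)))
  -[in leqRHS](card_ord n) -prod_nat_const.
by apply: leq_prod.
Qed.

(** Cramer's rule: [delta] is a nonzero minor of [N] of order the rank [r <= d], and [0 < M] allows
    [M ^ r] to be replaced by [M ^ d]. *)
Lemma int_row_span (m d M : nat) (N : 'M[int]_(m, d)) (v : 'rV[int]_d) :
  (0 < M)%N -> (forall i, \sum_j absz (N i j) <= M)%N ->
  (map_mx (intr : int -> rat) v <= map_mx intr N)%MS ->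
  exists delta : int, [/\ delta != 0, (absz delta <= M ^ d)%N &
    exists y : 'rV[int]_m, delta *: v = y *m N].
Proof.
move=> M0 rowN vN; set Nq := map_mx _ N in vN.
set f := maxrankfun Nq; set r := \rank Nq in f *.
pose N1 := rowsub f N; pose N1q := rowsub f Nq.
have fullN1 : row_full N1q^T.
  by rewrite /row_full mxrank_tr; have := maxrowsub_free Nq; rewrite /row_free.
(* [f] selects a basis of the row space and [g] columns that keep its rank, so [B] is square and
   invertible over the rationals. *)
pose g := fullrankfun fullN1; pose B := colsub g N1.
have N1E : N1q = map_mx intr N1 by apply/matrixP => i j; rewrite !mxE.
have unitB : map_mx (intr : int -> rat) B \in unitmx.
  rewrite -unitmx_tr (_ : _^T = rowsub g N1q^T) ?fullrowsub_unit //.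
  by apply/matrixP => i j; rewrite !mxE.
exists (\det B); split.
- by move: unitB; rewrite unitmxE det_map_mx unitfE intr_eq0.
- have rd : (r <= d)%N by apply: rank_leq_col.
  apply: leq_trans (leq_pexp2l M0 rd); apply: absz_det_le => i.
  apply: leq_trans (rowN (f i)).
  under eq_bigr do rewrite !mxE.
  exact: (leq_sum_inj (fun j => absz (N (f i) j)) (@fullrankfun_inj _ _ _ _ fullN1)).
(* Over the rationals [v = x *m N1] and [colsub g v = x *m B], so multiplying by [\adj B] gives
   [\det B *: x]; the last factor puts these coefficients on the selected rows. *)
exists (colsub g v *m \adj B *m rowsub f 1%:M).
have : (map_mx (intr : int -> rat) v <= N1q)%MS by rewrite eq_maxrowsub.
case/submxP => x vx.
have map_intr_inj (A1 A2 : 'rV[int]_d) :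
    map_mx (intr : int -> rat) A1 = map_mx intr A2 -> A1 = A2.
  by move=> /matrixP A12; apply/matrixP => i j; have := A12 i j; rewrite !mxE => /intr_inj.
apply: map_intr_inj.
rewrite -mulmxA mul_rowsub_mx mul1mx map_mxZ !map_mxM /= -/N1 -N1E map_mx_adj.
have -> : map_mx intr (colsub g v) = x *m map_mx (intr : int -> rat) B.
  have -> : map_mx intr (colsub g v) = colsub g (map_mx (intr : int -> rat) v).
    by apply/matrixP => i j; rewrite !mxE.
  rewrite vx; apply/matrixP => i j; rewrite !mxE; apply: eq_bigr => k _.
  by rewrite !mxE.
rewrite -(mulmxA x) mul_mx_adj det_map_mx mul_mx_scalar.
by rewrite -scalemxAl -vx.
Qed.

(** Representations are ordered, so when [A = B] the swapped pair counts and uniqueness forces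
    [a = b]. *)
Definition unique_pair (G : finZmodType) (A B : {set G}) : Prop :=
  exists a b, [/\ a \in A, b \in B &
    forall c d, c \in A -> d \in B -> a + b = c + d -> c = a /\ d = b].

(** A common divisor of [n] and [#|G|] greater than 1 would be at least [least_pdiv G]; hence the
    two are coprime and Bezout applies. *)
Lemma mulrz_small_eq0 (G : finZmodType) (x : G) (n : int) :
  n != 0 -> (absz n < least_pdiv G)%N -> x *~ n = 0 -> x = 0.
Proof.
move=> n0 nG xn.
have xG : x *+ #|G| = 0.
  have := expg_cardG (finset.in_setT x : x \in [set: G]%G).
  by rewrite FinRing.zmodXgE cardsT.
have x_n : x *+ absz n = 0.
  by case: n xn {n0 nG} => n //= /eqP; rewrite NegzE mulrNz oppr_eq0 => /eqP.
have co : coprime (absz n) #|G|.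
  apply/negPn/negP => ncop; have g0 : (0 < gcdn (absz n) #|G|)%N.
    by rewrite gcdn_gt0 absz_gt0 n0.
  have g1 : (1 < gcdn (absz n) #|G|)%N by rewrite ltn_neqAle eq_sym ncop.
  have := pdiv_min_dvd g1 (dvdn_gcdr _ _).
  have := dvdn_leq _ (dvdn_gcdl (absz n) #|G|); rewrite absz_gt0 => /(_ n0).
  by rewrite /least_pdiv in nG *; lia.
have n_gt0 : (0 < absz n)%N by rewrite absz_gt0.
case: (egcdnP #|G| n_gt0) => u v uv _.
rewrite (eqP co) in uv.
have : x *+ (u * absz n) = x *+ (v * #|G| + 1) by rewrite uv.
by rewrite mulrnDr !(mulnC _ (absz n), mulnC _ #|G|) !mulrnA x_n xG !mul0rn add0r.
Qed.

Definition spans (G : finZmodType) (D : {set G}) (M : nat) (a : G) : Prop :=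
  exists phi : G -> int,
    (\sum_(x in D) absz (phi x) <= M)%N /\ a = \sum_(x in D) x *~ phi x.

Lemma spans_mem (G : finZmodType) (D : {set G}) (a : G) :
  a \in D -> spans D 1 a.
Proof.
move=> aD; exists (fun x => (x == a)%:Z); split.
  rewrite (bigD1 a) //= eqxx big1 // => x /andP[_ /negPf ->].
  by [].
rewrite (bigD1 a) //= eqxx big1 ?addr0 // => x /andP[_ /negPf ->].
by rewrite mulr0z.
Qed.

Lemma spansD (G : finZmodType) (D : {set G}) (M M' : nat) (a b : G) :
  spans D M a -> spans D M' b -> spans D (M + M') (a + b).
Proof.
move=> [f [fM ->]] [g [gM ->]]; exists (fun x => f x + g x); split.
  apply: leq_trans (leq_add fM gM); rewrite -big_split /=.
  by apply: leq_sum => x _; lia.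
by rewrite -big_split /=; apply: eq_bigr => x _; rewrite mulrzDr.
Qed.

Lemma spansN (G : finZmodType) (D : {set G}) (M : nat) (a : G) :
  spans D M a -> spans D M (- a).
Proof.
move=> [f [fM ->]]; exists (fun x => - f x); split.
  by apply: leq_trans fM; apply: leq_sum => x _; lia.
by rewrite -sumrN; apply: eq_bigr => x _; rewrite mulrNz.
Qed.

Lemma spans_le (G : finZmodType) (D : {set G}) (M M' : nat) (a : G) :
  (M <= M')%N -> spans D M a -> spans D M' a.
Proof. by move=> MM' [f [fM ->]]; exists f; split=> //; apply: leq_trans MM'. Qed.

Lemma spans0 (G : finZmodType) (D : {set G}) : spans D 0 0.
Proof.
exists (fun=> 0); split; first by rewrite big1.
by rewrite big1 // => x _; rewrite mulr0z.
Qed.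

(** Induction on [#|A| + #|B|] with [S] fixed, so that one relation matrix [N] serves every step. A
    functional respecting the relations and nonconstant on [A] or on [B] reduces the problem to its
    maxima; two singletons end the descent. *)
Lemma span_unique_pair (G : finZmodType) (S D : {set G}) (M : nat) :
  (0 < M)%N -> (forall a, a \in S -> spans D M a) ->
  ((4 * M) ^ #|D| < least_pdiv G)%N ->
  forall A B : {set G}, A \subset S -> B \subset S ->
    (0 < #|A|)%N -> (0 < #|B|)%N -> unique_pair A B.
Proof.
move=> M0 spanS MD.
pose ev (v : 'rV[int]_#|D|) : G := \sum_i enum_val i *~ v 0 i.
have evD v w : ev (v + w) = ev v + ev w.
  by rewrite -big_split; apply: eq_bigr => i _; rewrite !mxE mulrzDr.
have evN v : ev (- v) = - ev v.
  by rewrite -sumrN; apply: eq_bigr => i _; rewrite !mxE mulrNz.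
have evZ c v : ev (c *: v) = ev v *~ c.
  by rewrite mulrz_suml; apply: eq_bigr => i _; rewrite !mxE mulrC mulrzA.
have evM m (y : 'rV[int]_m) (N : 'M[int]_(m, #|D|)) :
      ev (y *m N) = \sum_k ev (row k N) *~ y 0 k.
  rewrite /ev; under [RHS]eq_bigr do rewrite mulrz_suml.
  rewrite exchange_big; apply: eq_bigr => i _; rewrite mxE mulrz_sumr.
  by apply: eq_bigr => k _; rewrite !mxE mulrC mulrzA.
have phiP (a : G) : exists v : 'rV[int]_#|D|, a \in S ->
    (\sum_i absz (v 0%R i) <= M)%N /\ a = ev v.
  case aS: (a \in S); last by exists 0.
  have [f [fM fa]] := spanS a aS; exists (\row_i f (enum_val i)) => _.
  split; first by rewrite big_enum_val in fM; under eq_bigr do rewrite mxE.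
  rewrite {1}fa /ev [LHS]big_enum_val.
  by apply: eq_bigr => i _; rewrite mxE.
have [phi {}phiP] := choice phiP.
pose T : finType := (G * G * G * G)%type.
(* Quadruples that are not relations in [S] get the zero vector, so that [N] can be indexed by all
   of [T]. *)
pose relv (t : T) : 'rV[int]_#|D| :=
  let: (a, b, c, d) := t in
  if [&& a \in S, b \in S, c \in S, d \in S & a + b == c + d]
  then phi a + phi b - phi c - phi d else 0.
pose N : 'M[int]_(#|T|, #|D|) := \matrix_(k < #|T|) relv (enum_val k).
have relv_le t : (\sum_j absz (relv t 0%R j) <= 4 * M)%N.
  case: t => [[[a b] c] d] /=; case: ifP => [/and5P[aS bS cS dS _]|_]; last first.
    by rewrite big1 // => j _; rewrite mxE.
  apply: (@leq_trans (\sum_j (absz (phi a 0%R j) + absz (phi b 0%R j) +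
     absz (phi c 0%R j) + absz (phi d 0%R j)))%N).
    apply: leq_sum => j _; rewrite !mxE.
    move: (phi a 0 j) (phi b 0 j) (phi c 0 j) (phi d 0 j) => x y z t.
    have : (absz (x + y - z - t)%R <= absz x + absz y + absz z + absz t)%N by lia.
    by [].
  rewrite !big_split /=.
  have [aM _] := phiP a aS; have [bM _] := phiP b bS.
  have [cM _] := phiP c cS; have [dM _] := phiP d dS.
  by apply: leq_trans (leq_add (leq_add (leq_add aM bM) cM) dM) _; lia.
have ev_relv t : ev (relv t) = 0.
  case: t => [[[a b] c] d] /=; case: ifP => [/and5P[aS bS cS dS /eqP abcd]|_].
    rewrite !(evD, evN).
    have [_ <-] := phiP a aS; have [_ <-] := phiP b bS.
    have [_ <-] := phiP c cS; have [_ <-] := phiP d dS.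
    by rewrite abcd -addrA -opprD subrr.
  by rewrite /ev big1 // => i _; rewrite mxE mulr0z.
(* [delta *: (phi a - phi c)] is an integer combination of relations, so [ev] kills it; [delta] is
   nonzero and smaller than [least_pdiv G], hence [a - c] vanishes. *)
have collapse a c : a \in S -> c \in S ->
    (map_mx (intr : int -> rat) (phi a - phi c) <= map_mx intr N)%MS -> a = c.
  move=> aS cS /int_row_span -/(_ (4 * M)%N)[] //; first by rewrite muln_gt0.
    by move=> i; under eq_bigr do rewrite mxE; apply: relv_le.
  move=> delta [d0 dle [y dy]].
  apply/eqP; rewrite -subr_eq0; apply/eqP.
  apply: (mulrz_small_eq0 d0); first exact: leq_ltn_trans MD.
  have [_ ->] := phiP a aS; have [_ ->] := phiP c cS.
  rewrite -evN -evD -evZ dy evM big1 // => k _.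
  by rewrite rowK ev_relv mul0rz.
move=> A B.
have [n] := ubnP (#|A| + #|B|)%N; elim: n A B => // n IHn A B ABn AS BS A0 B0.
have descend (f : G -> rat) :
    (forall a b c d, a \in S -> b \in S -> c \in S -> d \in S ->
       a + b = c + d -> f a + f b = f c + f d) ->
    (exists a c, f a != f c /\ (a \in A /\ c \in A \/ a \in B /\ c \in B)) ->
    unique_pair A B.
  move=> f_hom [a [c [fac acAB]]].
  pose top (C : {set G}) := [set x in C | [forall y in C, f y <= f x]].
  have topS C : top C \subset C by apply/fintype.subsetP => x; rewrite inE => /andP[].
  have top0 (C : {set G}) : (0 < #|C|)%N -> (0 < #|top C|)%N.
    case/card_gt0P => x xC; have [y yC ymax] := arg_maxP f xC.
    have {}yC : y \in C := yC.
    apply/card_gt0P; exists y; rewrite inE yC; apply/forall_inP => z zC.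
    exact: ymax.
  have topE (C : {set G}) x y : x \in top C -> y \in C -> f y <= f x.
    by rewrite inE => /andP[_ /forall_inP]; apply.
  have topI (C : {set G}) x y : x \in top C -> y \in C -> f x <= f y -> y \in top C.
    move=> xC yC fxy; rewrite inE yC; apply/forall_inP => z zC.
    exact: le_trans (topE _ _ _ xC zC) fxy.
  have top_lt (C : {set G}) x y : x \in C -> y \in C -> f x != f y -> (#|top C| < #|C|)%N.
    move=> xC yC fxy; apply: proper_card; rewrite properE topS.
    apply/negP => /fintype.subsetP CC; move/negP: fxy; apply.
    by rewrite eq_le !(topE C) // CC.
  have [||||| a1 [b1 [a1A b1B ab1]]] := IHn (top A) (top B).
  - have := subset_leq_card (topS A); have := subset_leq_card (topS B).
    by case: acAB => -[aC cC]; have := top_lt _ _ _ aC cC fac; lia.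
  - exact: fintype.subset_trans AS.
  - exact: fintype.subset_trans BS.
  - exact: top0.
  - exact: top0.
  have a1A' := fintype.subsetP (topS A) _ a1A.
  have b1B' := fintype.subsetP (topS B) _ b1B.
  exists a1, b1; split=> // c1 d1 cA dB e.
  have fe : f a1 + f b1 = f c1 + f d1.
    by apply: f_hom e; try exact: (fintype.subsetP AS); exact: (fintype.subsetP BS).
  (* By [fe], the inequalities [f c1 <= f a1] and [f d1 <= f b1] are both equalities, so [c1] and
     [d1] are maxima as well. *)
  have := topE _ _ _ a1A cA; have := topE _ _ _ b1B dB => fb fa.
  apply: ab1 e; first by apply: topI a1A _ _ => //; lra.
  by apply: topI b1B _ _ => //; lra.
have separate a c : a \in S -> c \in S -> a != c ->
    a \in A /\ c \in A \/ a \in B /\ c \in B -> unique_pair A B.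
  move=> aS cS ac acAB.
  case: (boolP (map_mx (intr : int -> rat) (phi a - phi c) <= map_mx intr N)%MS).
    by move/(collapse _ _ aS cS) => /eqP; rewrite (negPf ac).
  (* Column [j] of the cokernel kills every row of [N] but not [phi a - phi c]: this is the
     functional to descend along. *)
  rewrite submxE => /matrix0Pn[i [j]]; rewrite ord1 => nz.
  pose K := cokermx (map_mx (intr : int -> rat) N).
  pose f (x : G) : rat := (map_mx (intr : int -> rat) (phi x) *m K) 0 j.
  have map_mxDN (v w : 'rV[int]_#|D|) : map_mx (intr : int -> rat) (v - w) =
      map_mx intr v - map_mx intr w.
    by apply/matrixP => k l; rewrite !mxE rmorphB.
  have map_mxDD (v w : 'rV[int]_#|D|) : map_mx (intr : int -> rat) (v + w) =
      map_mx intr v + map_mx intr w.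
    by apply/matrixP => k l; rewrite !mxE rmorphD.
  apply: (descend f); last first.
    exists a, c; split=> //; move: nz; rewrite map_mxDN mulmxBl !mxE subr_eq0.
    by rewrite /f !mxE.
  move=> a1 b1 c1 d1 a1S b1S c1S d1S e.
  have : (map_mx (intr : int -> rat) (phi a1 + phi b1 - phi c1 - phi d1) *m K) 0 j = 0.
    suff -> : map_mx (intr : int -> rat) (phi a1 + phi b1 - phi c1 - phi d1) =
        row (enum_rank (a1, b1, c1, d1)) (map_mx (intr : int -> rat) N).
      by rewrite -row_mul mulmx_coker !mxE.
    rewrite -map_row rowK enum_rankK /relv a1S b1S c1S d1S e eqxx.
    by [].
  rewrite !(map_mxDN, map_mxDD) !mulmxBl mulmxDl.
  rewrite -/(f a1) /f.
  move: (map_mx _ (phi a1) *m K) (map_mx _ (phi b1) *m K)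
    (map_mx _ (phi c1) *m K) (map_mx _ (phi d1) *m K) => r1 r2 r3 r4.
  by rewrite !mxE => h; apply/eqP; rewrite -subr_eq0 opprD addrA; apply/eqP.
case/card_gt0P: A0 => a aA; case/card_gt0P: B0 => b bB.
have aS := fintype.subsetP AS _ aA; have bS := fintype.subsetP BS _ bB.
case: (pselect (exists2 c, c \in A & a != c)) => [[c cA ac]|noA].
  by apply: (separate a c) => //; [apply: (fintype.subsetP AS)|left].
case: (pselect (exists2 d, d \in B & b != d)) => [[d dB bd]|noB].
  by apply: (separate b d) => //; [apply: (fintype.subsetP BS)|right].
exists a, b; split=> // c d cA dB _; split; apply/eqP; rewrite eq_sym.
  by apply/negPn/negP => ac; apply: noA; exists c.
by apply/negPn/negP => bd; apply: noB; exists d.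
Qed.

(** * Hitting sets from random colourings *)

Lemma leq_card_bigcup (I T : finType) (P : pred I) (F : I -> {set T}) :
  (#|\bigcup_(i | P i) F i| <= \sum_(i | P i) #|F i|)%N.
Proof.
elim/big_rec2: _ => [|i m B _ Bm]; first by rewrite cards0.
by apply: leq_trans (leq_card_setU _ _) _; rewrite leq_add2l.
Qed.

Lemma ex_max_indep (T : finType) (R : rel T) (B : {set T}) : symmetric R ->
  exists N : {set T}, [/\ N \subset B,
    {in N &, forall x y, x != y -> ~~ R x y} &
    {in B, forall x, exists2 n, n \in N & (x == n) || R x n}].
Proof.
move=> Rsym.
pose P (N : {set T}) := (N \subset B) &&
  [forall x in N, forall y in N, (x != y) ==> ~~ R x y].
have P0 : P finset.set0.
  by rewrite /P finset.sub0set; apply/forall_inP => x; rewrite inE.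
have [N /finset.maxsetP[/andP[NB /forall_inP indN] maxN] _] := maxset_exists P0.
exists N; split=> //.
  by move=> x y xN yN xy; have /forall_inP/(_ y yN)/implyP := indN x xN; apply.
move=> x xB; case: (boolP [exists n in N, (x == n) || R x n]) => [/exists_inP //|].
rewrite negb_exists_in => /forall_inP noN; exfalso.
have xN n : n \in N -> (x != n) && ~~ R x n by move/noN; rewrite negb_or.
have : x \notin N by apply/negP => /xN; rewrite eqxx.
move/negP; apply.
rewrite -(maxN (x |: N)); first by rewrite !inE eqxx.
- rewrite /P finset.subUset finset.sub1set xB NB /=.
  apply/forall_inP => y yN; apply/forall_inP => z zN; apply/implyP => yz.
  move: yN zN; rewrite !inE => /orP[/eqP yx|yN] /orP[/eqP zx|zN].
  + by rewrite yx zx eqxx in yz.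
  + by rewrite yx; have /andP[] := xN z zN.
  + by rewrite zx Rsym; have /andP[] := xN y yN.
  + by have /forall_inP/(_ z zN)/implyP := indN y yN; apply.
- exact: finset.subsetUr.
Qed.

(** The closed neighbourhoods of a maximal independent set cover [B]. *)
Lemma ex_large_indep (T : finType) (R : rel T) (B : {set T}) (d : nat) :
  symmetric R ->
  {in B, forall n, #|[set x in B | (x == n) || R x n]| <= d}%N ->
  exists N : {set T}, [/\ N \subset B,
    {in N &, forall x y, x != y -> ~~ R x y} & (#|B| <= #|N| * d)%N].
Proof.
move=> Rsym degR; have [N [NB indN domN]] := ex_max_indep B Rsym.
exists N; split=> //.
have BN : B \subset \bigcup_(n in N) [set x in B | (x == n) || R x n].
  apply/fintype.subsetP => x xB; have [n nN xn] := domN x xB.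
  by apply/finset.bigcupP; exists n; rewrite // inE xB.
apply: leq_trans (subset_leq_card BN) _.
apply: leq_trans (leq_card_bigcup _ _) _.
rewrite -sum_nat_const; apply: leq_sum => n nN.
by apply: degR; apply: (fintype.subsetP NB).
Qed.

Lemma leq_card_fiber (T : finType) (w : nat) (S : {set T}) (y : {ffun T -> 'I_w}) :
  (#|[set f : {ffun T -> 'I_w} | [forall x, (x \notin S) ==> (f x == y x)]]|
     <= w ^ #|S|)%N.
Proof.
pose F (x : T) : pred 'I_w := if x \in S then predT else pred1 (y x).
have sub : [set f : {ffun T -> 'I_w} | [forall x, (x \notin S) ==> (f x == y x)]]
    \subset family F.
  apply/fintype.subsetP => f; rewrite inE => /forallP fy; apply/familyP => x.
  by rewrite /F; case: ifP (fy x) => // _ /=; rewrite inE.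
apply: leq_trans (subset_leq_card sub) _.
rewrite card_family foldrE big_map big_enum /= (bigID (mem S)) /=.
rewrite [X in (_ * X)%N]big1 ?muln1 => [|x xS]; last by rewrite /F (negPf xS) card1.
rewrite -prod_nat_const; apply: leq_prod => x xS.
by rewrite /F xS card_ord.
Qed.

(** With denominators cleared: a random colouring leaves no [S k] entirely of colour [j] with
    probability at most [1 - w ^- 3] to the power [size ks]. Disjointness stands in for
    independence. *)
Lemma card_avoiding_colorings (T K : finType) (w : nat) (j : 'I_w)
    (S : K -> {set T}) (ks : seq K) :
  uniq ks -> (forall k, k \in ks -> #|S k| <= 3)%N ->
  {in ks &, forall k l, k != l -> [disjoint S k & S l]} ->
  (#|[set f : {ffun T -> 'I_w} |
       all (fun k => ~~ [forall x in S k, f x == j]) ks]| * (w ^ 3) ^ size ks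
     <= (w ^ 3 - 1) ^ size ks * w ^ #|T|)%N.
Proof.
have w0 : (0 < w)%N by case: w j => // -[].
elim: ks => [|k ks IH] /= => [_ _ _|/andP[kks uks] S3 disS].
  by rewrite !expn0 muln1 mul1n; apply: leq_trans (max_card _) _; rewrite card_ffun card_ord.
have tl : {subset ks <= k :: ks} by move=> l lks; rewrite inE lks orbT.
have {}IH := IH uks (fun l lks => S3 l (tl _ lks))
  (fun l m lks mks => disS l m (tl _ lks) (tl _ mks)).
pose X := [set f : {ffun T -> 'I_w} | all (fun k => ~~ [forall x in S k, f x == j]) ks].
pose Y := [set f in X | [forall x in S k, f x == j]].
(* Recolouring [S k] by [j] maps [X] to [Y], because the other sets avoid [S k]; a fibre is
   determined by the at most three old colours. *)
have XY : (#|X| <= #|Y| * w ^ 3)%N.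
  pose red (f : {ffun T -> 'I_w}) := [ffun x => if x \in S k then j else f x].
  rewrite -sum1_card (partition_big red (mem Y)) /=; last first.
    move=> f; rewrite !inE => /allP Xf; apply/andP; split; last first.
      by apply/forall_inP => x xS; rewrite ffunE xS.
    apply/allP => l lks; have := Xf l lks; apply: contra => /forall_inP redl.
    apply/forall_inP => x xl; have := redl x xl; rewrite ffunE ifN //.
    have kl : k != l by apply: contraNneq kks => ->.
    have dis := disS k l (mem_head _ _) (tl _ lks) kl.
    by rewrite (disjointFl dis xl).
  rewrite -sum_nat_const; apply: leq_sum => y _; rewrite sum1dep_card.
  apply: leq_trans (_ : w ^ #|S k| <= _)%N; last first.
    by rewrite leq_pexp2l // S3 ?mem_head.
  apply: leq_trans (leq_card_fiber (S k) y); apply: subset_leq_card.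
  apply/fintype.subsetP => f; rewrite !inE => /andP[_ /eqP <-].
  by apply/forallP => x; apply/implyP => xS; rewrite ffunE (negPf xS).
set Z := [set f : {ffun T -> 'I_w} | _ && _].
have ZX : (#|Z| + #|Y| = #|X|)%N.
  rewrite -(cardsID [set f : {ffun T -> 'I_w} | [forall x in S k, f x == j]] X) addnC.
  by congr (_ + _)%N; apply: eq_card => f; rewrite !inE.
rewrite (expnS (w ^ 3)) (expnS (w ^ 3 - 1)).
have : (#|Z| * w ^ 3 <= #|X| * (w ^ 3 - 1))%N by nia.
move: IH; rewrite -/X; move: (w ^ 3)%N => W IH ZW.
apply: leq_trans (_ : #|X| * (W - 1) * W ^ size ks <= _)%N.
  by rewrite mulnA leq_mul2r ZW orbT.
by rewrite -mulnA mulnCA -[leqRHS]mulnA leq_mul2l IH orbT.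
Qed.

(** This is [(1 - 1/W)^W <= 1/2], a case of Bernoulli's inequality, raised to the power [s]. *)
Lemma expn_pred_half (W s : nat) :
  (0 < W)%N -> ((W - 1) ^ (W * s) * 2 ^ s <= W ^ (W * s))%N.
Proof.
case: W => // n _; rewrite subn1 /=.
have bernoulli m : (n ^ m.+1 + m.+1 * n ^ m <= n.+1 ^ m.+1)%N.
  elim: m => [|m IH]; first by rewrite !expn1 expn0; lia.
  rewrite (expnS n.+1) !(expnS n m.+1); apply: leq_trans (leq_mul (leqnn n.+1) IH).
  by rewrite (expnS n m); nia.
rewrite !expnM -expnMn; case: s => // s; rewrite leq_exp2r //.
by apply: leq_trans (bernoulli n); rewrite expnS; lia.
Qed.

(** Union bound: each of the [w * #|J|] events [bad i j] has proportion at most [2 ^- s], so some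
    colouring avoids them all. Every colour class then hits every family, and the smallest class
    within [A] has the required size. *)
Lemma ex_small_hitting (T I K : finType) (A : {set T}) (J : {set I})
    (N : I -> {set K}) (S : I -> K -> {set T}) (w s : nat) :
  (0 < w)%N -> (w * #|J| < 2 ^ s)%N ->
  (forall i, i \in J -> [/\ (w ^ 3 * s <= #|N i|)%N,
     {in N i, forall k, S i k \subset A /\ (#|S i k| <= 3)%N} &
     {in N i &, forall k l, k != l -> [disjoint S i k & S i l]}]) ->
  exists D : {set T}, [/\ D \subset A, (#|D| * w <= #|A|)%N &
    forall i, i \in J -> exists2 k, k \in N i & S i k \subset D].
Proof.
move=> w0 wJ NS.
pose bad (i : I) (j : 'I_w) := [set f : {ffun T -> 'I_w} |
  all (fun k => ~~ [forall x in S i k, f x == j]) (enum (N i))].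
have bad_card i j : i \in J -> (#|bad i j| * 2 ^ s <= w ^ #|T|)%N.
  move=> iJ; have [Nbig SA disS] := NS i iJ.
  (* Only [t] of the sets are kept; they halve the proportion of bad colourings [s] times. *)
  pose t := (w ^ 3 * s)%N; pose ks := take t (enum (N i)).
  have szks : size ks = t.
    by rewrite size_takel // -cardE.
  have ksN k : k \in ks -> k \in N i by move/mem_take; rewrite mem_enum.
  have uks : uniq ks by rewrite take_uniq ?enum_uniq.
  have := card_avoiding_colorings j uks (fun k kks => (SA k (ksN k kks)).2)
    (fun k l kks lks => disS k l (ksN k kks) (ksN l lks)).
  rewrite szks; set X := [set _ | _] => cardX.
  have bX : bad i j \subset X.
    apply/fintype.subsetP => f; rewrite !inE => /allP bf; apply/allP => k kks.
    by apply: bf; apply: mem_take kks.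
  have W0 : (0 < w ^ 3)%N by rewrite expn_gt0 w0.
  have half := expn_pred_half s W0; rewrite -/t in half.
  have Wt0 : (0 < (w ^ 3) ^ t)%N by rewrite expn_gt0 W0.
  have := subset_leq_card bX.
  rewrite -(leq_pmul2r Wt0) => /leq_trans/(_ cardX) {}cardX.
  rewrite -(leq_pmul2r Wt0).
  rewrite mulnAC; apply: leq_trans (leq_mul cardX (leqnn _)) _.
  by rewrite mulnAC mulnC leq_mul2l half orbT.
have [f fgood] : exists f : {ffun T -> 'I_w}, forall i j, i \in J -> f \notin bad i j.
  have : (#|\bigcup_(i in J) \bigcup_j bad i j| < #|{ffun T -> 'I_w}|)%N.
    rewrite card_ffun card_ord.
    have s0 : (0 < 2 ^ s)%N by rewrite expn_gt0.
    rewrite -(ltn_pmul2r s0).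
    apply: (@leq_ltn_trans (\sum_(i in J) \sum_(j : 'I_w) w ^ #|T|)).
      apply: leq_trans (leq_mul (leq_card_bigcup _ _) (leqnn _)) _.
      rewrite big_distrl; apply: leq_sum => i iJ /=.
      apply: leq_trans (leq_mul (leq_card_bigcup _ _) (leqnn _)) _.
      by rewrite big_distrl; apply: leq_sum => j _; apply: bad_card.
    rewrite !sum_nat_const card_ord mulnA mulnC ltn_pmul2l ?expn_gt0 ?w0 //.
    by rewrite mulnC.
  move=> lt; have /finset.set0Pn[f] : (~: (\bigcup_(i in J) \bigcup_j bad i j)) != finset.set0.
    by rewrite -card_gt0 cardsCs finset.setCK subn_gt0.
  rewrite inE => fn; exists f => i j iJ; apply: contra fn => fb.
  by apply/finset.bigcupP; exists i => //; apply/finset.bigcupP; exists j.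
pose D j := [set x in A | f x == j].
have [j Dj] : exists j, (#|D j| * w <= #|A|)%N.
  case: (@arg_minnP _ (Ordinal w0) xpredT (fun j => #|D j|) isT) => j _ jmin.
  exists j; rewrite mulnC -[in leqLHS](card_ord w) -sum_nat_const.
  rewrite -[leqRHS]sum1_card (partition_big f predT) //=.
  apply: leq_sum => l _; rewrite sum1dep_card; apply: leq_trans (jmin l isT) _.
  by apply: subset_leq_card; apply/fintype.subsetP => x; rewrite !inE.
exists (D j); split=> //.
  by apply/fintype.subsetP => x; rewrite inE => /andP[].
move=> i iJ; have [_ SA _] := NS i iJ.
have := fgood i j iJ; rewrite inE => /allPn[k]; rewrite mem_enum => kN.
rewrite negbK => /forall_inP fk; exists k => //; apply/fintype.subsetP => x xS.
by rewrite inE (fintype.subsetP (SA k kN).1) //= fk.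
Qed.

(** * Popular differences and detours *)

Definition popular (G : finZmodType) (A : {set G}) (tau : nat) : {set G} :=
  [set h | tau <= #|[set x in A | (x + h)%R \in A]|]%N.

Definition step (G : finZmodType) (A P X : {set G}) : {set G} :=
  [set y in A | [exists x in X, y - x \in P]].

Definition ball (G : finZmodType) (A P : {set G}) (r : nat) (x : G) : {set G} :=
  iter r (step A P) [set x].

Lemma ball_sub (G : finZmodType) (A P : {set G}) (r : nat) (x : G) :
  x \in A -> ball A P r x \subset A.
Proof.
move=> xA; case: r => [|r] /=; first by rewrite finset.sub1set.
by apply/fintype.subsetP => y; rewrite inE => /andP[].
Qed.

Lemma sub_step (G : finZmodType) (A P X : {set G}) :
  0 \in P -> X \subset A -> X \subset step A P X.
Proof.
move=> P0 /fintype.subsetP XA; apply/fintype.subsetP => x xX.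
by rewrite inE XA //=; apply/exists_inP; exists x; rewrite // subrr.
Qed.

Lemma ball_center (G : finZmodType) (A P : {set G}) (r : nat) (x : G) :
  0 \in P -> x \in A -> x \in ball A P r x.
Proof.
move=> P0 xA; elim: r => [|r IH] /=; first by rewrite inE.
exact: (fintype.subsetP (sub_step P0 (ball_sub _ _ xA))).
Qed.

(** Each step before stabilisation adds an element, and a ball that has stabilised stays so. *)
Lemma ball_closed_or_large (G : finZmodType) (A P : {set G}) (r : nat) (x : G) :
  0 \in P -> x \in A ->
  step A P (ball A P r x) = ball A P r x \/ (r < #|ball A P r x|)%N.
Proof.
move=> P0 xA; elim: r => [|r [IH|IH]] /=; first by right; rewrite cards1.
  by left; rewrite /ball /= -/(ball A P r x) !IH.
have sub := sub_step P0 (ball_sub P r xA).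
have [eq_ball|neq_ball] := eqVneq (step A P (ball A P r x)) (ball A P r x).
  by left; rewrite /ball /= -/(ball A P r x) !eq_ball.
right; apply: leq_ltn_trans IH _; apply: proper_card.
by rewrite finset.properEneq eq_sym neq_ball.
Qed.

Lemma ball_spans (G : finZmodType) (A P D : {set G}) (m r : nat) (x y : G) :
  (forall h, h \in P -> spans D m h) ->
  y \in ball A P r x -> spans D (r * m) (y - x).
Proof.
move=> PD; elim: r y => [|r IH] y /=.
  by rewrite inE => /eqP ->; rewrite subrr; apply: spans0.
rewrite inE => /andP[_ /exists_inP[z zb yzP]].
rewrite mulSn (_ : y - x = (y - z) + (z - x)); last by rewrite addrA subrK.
exact: spansD (PD _ yzP) (IH _ zb).
Qed.

Definition detours (G : finZmodType) (A P : {set G}) (a b : G) : {set G * G} :=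
  [set p | [&& p.1 \in A, p.2 \in A, a + b == p.1 + p.2,
                p.1 - a \notin P & p.2 - a \notin P]].

Definition detoured (G : finZmodType) (A P : {set G}) (a : G) : {set G} :=
  [set b in A | detours A P a b != finset.set0].

(** A chosen detour; the default [(0, 0)] is not reached when [b] is in [detoured A P a]. *)
Definition detour (G : finZmodType) (A P : {set G}) (a b : G) : G * G :=
  odflt (0, 0) [pick p in detours A P a b].

Definition detour_set (G : finZmodType) (A P : {set G}) (a b : G) : {set G} :=
  [set b; (detour A P a b).1; (detour A P a b).2].

Lemma cards3_le (T : finType) (x y z : T) : (#|[set x; y; z]| <= 3)%N.
Proof.
apply: leq_trans (leq_card_setU _ _) _; rewrite cards1 addn1 ltnS.
by apply: leq_trans (leq_card_setU _ _) _; rewrite !cards1.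
Qed.

Lemma detourP (G : finZmodType) (A P : {set G}) (a b : G) :
  b \in detoured A P a -> detour A P a b \in detours A P a b.
Proof.
rewrite inE => /andP[_ /finset.set0Pn[p pd]]; rewrite /detour.
by case: pickP => [//|/(_ p)]; rewrite pd.
Qed.

Lemma detour_set_sub (G : finZmodType) (A P : {set G}) (a b : G) :
  b \in detoured A P a -> detour_set A P a b \subset A.
Proof.
move=> bd; have := detourP bd; rewrite inE => /and5P[cA dA _ _ _].
move: bd; rewrite inE => /andP[bA _].
by rewrite /detour_set !finset.subUset !finset.sub1set bA cA dA.
Qed.

Lemma spans_detour (G : finZmodType) (A P D : {set G}) (a b : G) :
  b \in detoured A P a -> detour_set A P a b \subset D -> spans D 3 a.
Proof.
move=> /detourP; rewrite inE => /and5P[_ _ /eqP abcd _ _].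
rewrite /detour_set !finset.subUset !finset.sub1set => /andP[/andP[bD cD] dD].
rewrite (_ : a = (detour A P a b).1 + (detour A P a b).2 - b); last first.
  by rewrite -abcd addrK.
exact: spansD (spansD (spans_mem cD) (spans_mem dD)) (spansN (spans_mem bD)).
Qed.

(* An element c with c - a unpopular occurs in fewer than tau of the equations
   a + b = c + d, since d determines b and d, d + (c - a) both lie in A. *)
Lemma card_detour_through (G : finZmodType) (A : {set G}) (tau : nat) (a u : G) :
  (#|[set b in detoured A (popular A tau) a |
      u \in detour_set A (popular A tau) a b]| <= 2 * tau + 1)%N.
Proof.
set P := popular A tau; set X := [set b in _ | _].
pose X1 := [set b in detoured A P a | (detour A P a b).1 == u].
pose X2 := [set b in detoured A P a | (detour A P a b).2 == u].
(* The element [u] is the first or second component of the detour, at most [tau] times each, or [b]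
   itself, once. *)
have XU : X \subset X1 :|: X2 :|: [set u].
  apply/fintype.subsetP => b; rewrite !inE => /andP[->] /=.
  by rewrite ![u == _]eq_sym => /orP[/orP[->|->]|->]; rewrite ?orbT.
have unpop v (Y : {set G}) : (forall b, b \in Y -> v - a \notin P /\
    (b \in A /\ a + b - v \in A)) -> (#|Y| <= tau)%N.
  move=> Yv; case: (finset.set_0Vmem Y) => [->|[b0 b0Y]]; first by rewrite cards0.
  have [vP _] := Yv b0 b0Y; move: vP; rewrite inE -ltnNge => /ltnW; apply: leq_trans.
  rewrite -(card_imset _ (addIr (a - v))); apply: subset_leq_card.
  apply/fintype.subsetP => _ /finset.imsetP[b bY ->].
  have [_ [bA dA]] := Yv b bY; rewrite inE addrA (addrC b) dA /=.
  by rewrite addrA subrK addrC addKr.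
have X1le : (#|X1| <= tau)%N.
  apply: (unpop u) => b; rewrite inE => /andP[bd /eqP du].
  have := detourP bd; rewrite inE du => /and5P[_ dA /eqP e uP _]; split=> //.
  by move: bd; rewrite inE e addrC addKr dA => /andP[-> _].
have X2le : (#|X2| <= tau)%N.
  apply: (unpop u) => b; rewrite inE => /andP[bd /eqP du].
  have := detourP bd; rewrite inE du => /and5P[dA _ /eqP e _ uP]; split=> //.
  by move: bd; rewrite inE e addrK dA => /andP[-> _].
apply: leq_trans (subset_leq_card XU) _.
apply: leq_trans (leq_card_setU _ _) _; rewrite cards1 leq_add2r.
apply: leq_trans (leq_card_setU _ _) _; lia.
Qed.

(** Each of the at most three elements of a detour set lies in at most [2 * tau + 1] detour sets,
    which bounds the degree of the intersection graph. *)
Lemma ex_disjoint_detours (G : finZmodType) (A : {set G}) (tau t : nat) (a : G) :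
  (3 * (2 * tau + 1) * t <= #|detoured A (popular A tau) a|)%N ->
  exists N : {set G}, [/\ N \subset detoured A (popular A tau) a, (t <= #|N|)%N &
    {in N &, forall b b', b != b' ->
      [disjoint detour_set A (popular A tau) a b & detour_set A (popular A tau) a b']}].
Proof.
set P := popular A tau => big.
pose R b b' := ~~ [disjoint detour_set A P a b & detour_set A P a b'].
have Rsym : symmetric R by move=> b b'; rewrite /R disjoint_sym.
have [|N [NB indN cardN]] := @ex_large_indep _ R (detoured A P a)
    (3 * (2 * tau + 1)) Rsym.
  move=> n nB.
  have sub : [set b in detoured A P a | (b == n) || R b n] \subset
      \bigcup_(u in detour_set A P a n)
        [set b in detoured A P a | u \in detour_set A P a b].
    apply/fintype.subsetP => b; rewrite inE => /andP[bB bn].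
    suff [u un ub] : exists2 u, u \in detour_set A P a n & u \in detour_set A P a b.
      by apply/finset.bigcupP; exists u; rewrite // inE bB.
    case/orP: bn => [/eqP ->|]; first by exists n; rewrite !inE eqxx.
    rewrite /R => /pred0Pn[u /andP[ub un]].
    by exists u.
  apply: leq_trans (subset_leq_card sub) _.
  apply: leq_trans (leq_card_bigcup _ _) _.
  apply: (@leq_trans (\sum_(u in detour_set A P a n) (2 * tau + 1))).
    by apply: leq_sum => u _; apply: card_detour_through.
  by rewrite sum_nat_const leq_mul2r cards3_le orbT.
exists N; split=> //; last by move=> b b' bN b'N bb'; have := indN _ _ bN b'N bb'; rewrite negbK.
by move: (leq_trans big cardN); rewrite mulnC leq_pmul2r // muln_gt0 /= addn1.
Qed.

(** The pairs at [x] and [y] meet only if [y] is [x], [x + h] or [x - h], whence the factor 3. *)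
Lemma ex_disjoint_pairs (G : finZmodType) (A : {set G}) (t : nat) (h : G) :
  h \in popular A (3 * t) ->
  exists N : {set G}, [/\ {in N, forall x, [set x; x + h] \subset A}, (t <= #|N|)%N &
    {in N &, forall x y, x != y -> [disjoint [set x; x + h] & [set y; y + h]]}].
Proof.
rewrite inE; set X := [set x in A | _] => big.
pose R x y := ~~ [disjoint [set x; x + h] & [set y; y + h]].
have Rsym : symmetric R by move=> b b'; rewrite /R disjoint_sym.
have [|N [NB indN cardN]] := @ex_large_indep _ R X 3 Rsym.
  move=> n nB; apply: leq_trans (cards3_le n (n + h) (n - h)).
  apply: subset_leq_card; apply/fintype.subsetP => x; rewrite inE => /andP[_].
  rewrite !inE => /orP[->//|/pred0Pn[u /andP[]]]; rewrite !inE.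
  move=> /orP[/eqP ux|/eqP ux] /orP[/eqP un|/eqP un].
  - by rewrite -ux un eqxx.
  - by rewrite -ux un eqxx orbT.
  - by rewrite -un ux addrK eqxx orbT.
  - by move: ux; rewrite un => /addIr ->; rewrite eqxx.
exists N; split.
- by move=> x /(fintype.subsetP NB); rewrite inE finset.subUset !finset.sub1set.
- by move: (leq_trans big cardN); rewrite mulnC leq_pmul2r.
- by move=> b b' bN b'N bb'; have := indN b b' bN b'N bb'; rewrite negbK.
Qed.

Lemma card_popular (G : finZmodType) (A : {set G}) (tau : nat) :
  (0 < tau)%N -> (#|popular A tau| <= #|A| ^ 2)%N.
Proof.
move=> tau0; rewrite -mulnn -cardsX.
apply: leq_trans (leq_imset_card (fun p : G * G => p.2 - p.1) _).
apply: subset_leq_card; apply/fintype.subsetP => h; rewrite inE => /(leq_trans tau0).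
case/card_gt0P => x; rewrite inE => /andP[xA xhA].
by apply/finset.imsetP; exists (x, x + h); rewrite ?inE ?xA //= addrC addKr.
Qed.

Lemma leq_sum_disjoint (I T : finType) (A : {set T}) (N : {set I}) (F : I -> {set T}) :
  {in N, forall i, F i \subset A} ->
  {in N &, forall i j, i != j -> [disjoint F i & F j]} ->
  (\sum_(i in N) #|F i| <= #|A|)%N.
Proof.
move=> FA disF; under eq_bigr do rewrite -sum1_card big_mkcond /=.
rewrite exchange_big -sum1_card [leqRHS]big_mkcond /=; apply: leq_sum => x _.
have [/existsP[i /andP[iN xi]]|noi] := boolP [exists i, (i \in N) && (x \in F i)].
  rewrite (bigD1 i) //= xi (fintype.subsetP (FA i iN)) // big1 // => j /andP[jN ji].
  by rewrite (disjointFl (disF j i jN iN ji) xi).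
rewrite big1 // => i iN; case: ifP => // xi.
by case/negP: noi; apply/existsP; exists i; rewrite iN.
Qed.

(* Take [a + b] unique in [C + C']. Its other representation in [A + A] cannot
   use one element of each of these two closed sets, so it misses one of them. *)
Lemma ex_detoured (G : finZmodType) (A P C C' : {set G}) :
  no_unique_sum A -> 0 \in P -> C \subset A -> C' \subset A -> [disjoint C & C'] ->
  (0 < #|C|)%N -> (0 < #|C'|)%N ->
  step A P C = C -> step A P C' = C' ->
  (4 ^ (#|C| + #|C'|) < least_pdiv G)%N ->
  exists a b, [/\ a \in C, b \in C' &
    (b \in detoured A P a) || (a \in detoured A P b)].
Proof.
move=> nus P0 CA C'A dis C0 C'0 clC clC' small.
have [|||||||a [b [aC bC' uab]]] := @span_unique_pair G (C :|: C') (C :|: C') 1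
  _ _ _ C C'; rewrite //.
- by move=> a; apply: spans_mem.
- apply: leq_ltn_trans small; rewrite muln1 leq_pexp2l //.
  exact: leq_card_setU.
- exact: finset.subsetUl.
- exact: finset.subsetUr.
have aA := fintype.subsetP CA _ aC; have bA := fintype.subsetP C'A _ bC'.
exists a, b; split=> //.
have closed (X : {set G}) x y : step A P X = X -> x \in X -> y \in A -> y \notin X ->
    y - x \notin P.
  move=> clX xX yA; apply: contra => yxP; rewrite -clX inE yA /=.
  by apply/exists_inP; exists x.
move/forall_inP: nus => /(_ a aA)/forall_inP/(_ b bA)/exists_inP[c cA /exists_inP[d dA]].
case/andP=> /eqP e ne.
case: (boolP ((c \in C) || (d \in C))) => [cdC|]; last first.
  rewrite negb_or => /andP[cC dC]; apply/orP; left; rewrite inE bA /=.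
  apply/finset.set0Pn; exists (c, d); rewrite inE /= cA dA e eqxx /=.
  by rewrite (closed C a c) // (closed C a d).
case: (boolP ((c \in C') || (d \in C'))) => [cdC'|]; last first.
  rewrite negb_or => /andP[cC dC]; apply/orP; right; rewrite inE aA /=.
  apply/finset.set0Pn; exists (c, d); rewrite inE /= cA dA -e addrC eqxx /=.
  by rewrite (closed C' b c) // (closed C' b d).
exfalso; case/orP: cdC => [cC|dC].
  case/orP: cdC' => [cC'|dC']; first by rewrite (disjointFr dis cC) in cC'.
  by have [ca db] := uab c d cC dC' e; move: ne; rewrite ca db !eqxx.
case/orP: cdC' => [cC'|dC']; last by rewrite (disjointFr dis dC) in dC'.
have [|da cb] := uab d c dC cC'; first by rewrite e addrC.
by move: ne; rewrite da cb !eqxx orbT.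
Qed.

(** * Small spanning sets *)

Lemma spans_subset (G : finZmodType) (D D' : {set G}) (M : nat) (a : G) :
  D \subset D' -> spans D M a -> spans D' M a.
Proof.
move=> DD' [f [fM ->]]; exists (fun x => if x \in D then f x else 0).
rewrite (big_setID D) (finset.setIidPr DD') /= [X in (_ + X)%N]big1 => [|x]; last first.
  by rewrite inE => /andP[/negPf ->].
rewrite addn0; split; first by under eq_bigr => x xD do rewrite xD.
rewrite [RHS](big_setID D) (finset.setIidPr DD') /= [X in _ = _ + X]big1 => [|x]; last first.
  by rewrite inE => /andP[/negPf ->]; rewrite mulr0z.
by rewrite addr0; apply: eq_bigr => x ->.
Qed.

(** The threshold provides the [w ^ 3 * s] disjoint triples that random hitting requires; a triple
    inside [D] expresses [a] with three terms. *)
Lemma ex_detour_basis (G : finZmodType) (A : {set G}) (tau w s : nat) :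
  (0 < w)%N -> (w * #|A| < 2 ^ s)%N ->
  exists D : {set G}, (#|D| * w <= #|A|)%N /\
    forall a, a \in A ->
      (3 * (2 * tau + 1) * (w ^ 3 * s) <= #|detoured A (popular A tau) a|)%N ->
      spans D 3 a.
Proof.
move=> w0 wA; set P := popular A tau.
pose J := [set a in A | 3 * (2 * tau + 1) * (w ^ 3 * s) <= #|detoured A P a|]%N.
have NP (a : G) : exists N : {set G}, a \in J ->
    [/\ N \subset detoured A P a, (w ^ 3 * s <= #|N|)%N &
    {in N &, forall b b', b != b' ->
      [disjoint detour_set A P a b & detour_set A P a b']}].
  case aJ: (a \in J); last by exists finset.set0.
  move: aJ; rewrite inE => /andP[aA /ex_disjoint_detours[N HN]].
  by exists N.
have [N {}NP] := choice NP.
have wJ : (w * #|J| < 2 ^ s)%N.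
  apply: leq_ltn_trans wA; rewrite leq_mul2l; apply/orP; right.
  by apply: subset_leq_card; apply/fintype.subsetP => a; rewrite inE => /andP[].
have [|D [DA Dw hitD]] := ex_small_hitting (A := A) (N := N) (S := detour_set A P) w0 wJ.
  move=> a aJ; have [Nd Nt Ndis] := NP a aJ; split=> // b bN.
  split; first exact: detour_set_sub (fintype.subsetP Nd _ bN).
  exact: cards3_le.
exists D; split=> // a aA big.
have aJ : a \in J by rewrite inE aA.
have [b bN bD] := hitD a aJ; have [Nd _ _] := NP a aJ.
exact: spans_detour (fintype.subsetP Nd _ bN) bD.
Qed.

(** A pair [x], [x + h] inside [D] expresses [h] as a difference. There are at most [#|A| ^ 2]
    popular [h], which is the number of families to hit. *)
Lemma ex_popular_basis (G : finZmodType) (A : {set G}) (w s : nat) :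
  (0 < w)%N -> (0 < s)%N -> (w * #|A| ^ 2 < 2 ^ s)%N ->
  exists D : {set G}, (#|D| * w <= #|A|)%N /\
    forall h, h \in popular A (3 * (w ^ 3 * s)) -> spans D 2 h.
Proof.
move=> w0 s0 wA; set t := (w ^ 3 * s)%N.
have t0 : (0 < t)%N by rewrite muln_gt0 expn_gt0 w0.
have NP (h : G) : exists N : {set G}, h \in popular A (3 * t) ->
    [/\ {in N, forall x, [set x; x + h] \subset A}, (t <= #|N|)%N &
    {in N &, forall x y, x != y -> [disjoint [set x; x + h] & [set y; y + h]]}].
  case hP: (h \in popular A (3 * t)); last by exists finset.set0.
  by have [N HN] := ex_disjoint_pairs hP; exists N.
have [N {}NP] := choice NP.
have wJ : (w * #|popular A (3 * t)| < 2 ^ s)%N.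
  by apply: leq_ltn_trans wA; rewrite leq_mul2l card_popular ?orbT // muln_gt0.
have [|D [DA Dw hitD]] := ex_small_hitting (A := A) (N := N)
  (S := fun h x => [set x; x + h]) w0 wJ.
  move=> h hP; have [NA Nt Ndis] := NP h hP; split=> // x xN.
  by split; [apply: NA | rewrite cards2; case: (_ != _)].
exists D; split=> // h hP; have [x xN] := hitD h hP.
rewrite finset.subUset !finset.sub1set => /andP[xD xhD].
rewrite (_ : h = x + h - x); last by rewrite addrC addKr.
exact: spansD (spans_mem xhD) (spansN (spans_mem xD)).
Qed.

(** Two distinct centres yield a pair counted by [E] or by its transpose [E'], each of size at most
    [#|A| * beta]. Since the balls are disjoint, that pair determines both centres. *)
Lemma card_closed_centers (G : finZmodType) (A P N : {set G}) (w beta : nat) :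
  no_unique_sum A -> 0 \in P -> N \subset A ->
  {in N &, forall x y, x != y -> [disjoint ball A P w x & ball A P w y]} ->
  {in N, forall n, (#|ball A P w n| <= w)%N /\
     {in ball A P w n, forall a, #|detoured A P a| <= beta}%N} ->
  (4 ^ (2 * w) < least_pdiv G)%N ->
  (#|N| ^ 2 <= #|N| + 2 * (#|A| * beta))%N.
Proof.
move=> nus P0 NA disN badN small.
pose E := [set p : G * G |
  [&& p.1 \in A, #|detoured A P p.1| <= beta & p.2 \in detoured A P p.1]]%N.
pose E' := [set p : G * G | (p.2, p.1) \in E].
have cardE : (#|E| <= #|A| * beta)%N.
  rewrite -sum1_card (eq_bigl (fun p : G * G =>
    ((p.1 \in A) && (#|detoured A P p.1| <= beta)%N) &&
    (p.2 \in detoured A P p.1))); last first.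
    by move=> p; rewrite inE andbA.
  rewrite -(pair_big_dep (fun a => (a \in A) && (#|detoured A P a| <= beta)%N)
    (fun a b => b \in detoured A P a) (fun _ _ => 1%N)) /=.
  rewrite -sum_nat_const [leqRHS](bigID (fun a => #|detoured A P a| <= beta)%N) /=.
  apply: leq_trans (leq_addr _ _); apply: leq_sum => a /andP[_ ab].
  by rewrite sum1_card.
have swap_inj : injective (fun p : G * G => (p.2, p.1)) by move=> [a b] [c d] [-> ->].
have cardE' : (#|E'| <= #|A| * beta)%N.
  apply: leq_trans cardE; rewrite -(card_imset (mem E') swap_inj).
  apply: subset_leq_card; apply/fintype.subsetP => _ /finset.imsetP[[a b] + ->].
  by rewrite inE.
pose center (a : G) : G := odflt 0 [pick n in N | a \in ball A P w n].
have centerE a n : n \in N -> a \in ball A P w n -> center a = n.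
  move=> nN an; rewrite /center; case: pickP => [m /andP[mN am]|/(_ n)]; last by rewrite nN an.
  apply/eqP/negPn/negP => mn; have := disN m n mN nN mn.
  by move=> dis; rewrite (disjointFr dis am) in an.
pose Q := [set p : G * G | [&& p.1 \in N, p.2 \in N & p.1 != p.2]].
have QE : Q \subset (fun p => (center p.1, center p.2)) @: (E :|: E').
  apply/fintype.subsetP => -[n n']; rewrite inE /= => /and3P[nN n'N nn'].
  have nA := fintype.subsetP NA _ nN; have n'A := fintype.subsetP NA _ n'N.
  have [sz bad] := badN n nN; have [sz' bad'] := badN n' n'N.
  have closed m : m \in N -> step A P (ball A P w m) = ball A P w m.
    move=> mN; have [szm _] := badN m mN.
    by case: (ball_closed_or_large w P0 (fintype.subsetP NA _ mN)) => //; rewrite ltnNge szm.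
  have nonempty m : m \in N -> (0 < #|ball A P w m|)%N.
    by move=> mN; apply/card_gt0P; exists m; apply: ball_center; rewrite // (fintype.subsetP NA).
  have [|a [b [an bn' ab]]] := ex_detoured nus P0 (ball_sub P w nA) (ball_sub P w n'A)
    (disN _ _ nN n'N nn') (nonempty n nN) (nonempty n' n'N) (closed n nN) (closed n' n'N).
    apply: leq_ltn_trans small; rewrite leq_pexp2l // mul2n -addnn.
    exact: leq_add.
  have aA := fintype.subsetP (ball_sub P w nA) _ an.
  have bA := fintype.subsetP (ball_sub P w n'A) _ bn'.
  apply/finset.imsetP; exists (a, b); last by rewrite /= (centerE a n) // (centerE b n').
  by move: ab; rewrite !inE /= aA bA (bad a an) (bad' b bn') /=.
have cardQ : (#|N| ^ 2 <= #|N| + #|Q|)%N.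
  rewrite -mulnn -cardsX.
  have sub : finset.setX N N \subset (fun n => (n, n)) @: N :|: Q.
    apply/fintype.subsetP => -[n m]; rewrite !inE /= => /andP[nN mN].
    case: (eqVneq n m) => [<-|nm]; last by rewrite nN mN orbT.
    by apply/orP; left; apply/finset.imsetP; exists n.
  apply: leq_trans (subset_leq_card sub) _.
  apply: leq_trans (leq_card_setU _ _) _; rewrite leq_add2r; exact: leq_imset_card.
apply: leq_trans cardQ _; rewrite leq_add2l.
apply: leq_trans (subset_leq_card QE) _.
apply: leq_trans (leq_imset_card _ _) _.
apply: leq_trans (leq_card_setU _ _) _.
by rewrite mul2n -addnn leq_add.
Qed.

(** [D1] spans the points with many detours, [D2] the popular differences. These two and the [large]
    centres cost [#|A| / w] each, the [closed] centres twice that, hence the 5. Going from a point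
    to a common point of two balls, to a centre, and to a point with many detours costs [2 * w]
    three times, plus 3. [beta] is the threshold of [ex_detour_basis] for [tau = 3 * t]. *)
Lemma ex_small_basis (G : finZmodType) (A : {set G}) (w s : nat) :
  let t := (w ^ 3 * s)%N in
  let beta := (3 * (6 * t + 1) * t)%N in
  no_unique_sum A -> (0 < w)%N -> (0 < s)%N -> (w * #|A| ^ 2 < 2 ^ s)%N ->
  (beta * w ^ 2 <= #|A|)%N -> (4 ^ (2 * w) < least_pdiv G)%N ->
  exists D : {set G}, (#|D| * w <= 5 * #|A|)%N /\
    forall a, a \in A -> spans D (6 * w + 3) a.
Proof.
move=> t beta nus w0 s0 wAs betaA small.
have t0 : (0 < t)%N by rewrite muln_gt0 expn_gt0 w0.
have beta0 : (0 < beta)%N by rewrite /beta; clearbody t; lia.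
have A0 : (0 < #|A|)%N.
  by apply: leq_trans betaA; rewrite muln_gt0 beta0 expn_gt0 w0.
have wA : (w * #|A| < 2 ^ s)%N by apply: leq_ltn_trans wAs; rewrite leq_mul2l -mulnn leq_pmulr ?orbT.
pose P := popular A (3 * t).
have P0 : 0 \in P.
  rewrite inE (_ : [set x in A | _] = A); last first.
    by apply/finset.setP => x; rewrite !inE addr0 andbb.
  apply: leq_trans betaA; have : (0 < w ^ 2)%N by rewrite expn_gt0 w0.
  by rewrite /beta; clearbody t; nia.
have [D1 [D1w D1P]] := ex_detour_basis (3 * t) w0 wA.
have [D2 [D2w D2P]] := ex_popular_basis w0 s0 wAs.
rewrite -/t -/P in D1P D2P.
pose B n := ball A P w n.
have [N [NA indN domN]] := @ex_max_indep _ (fun x y => ~~ [disjoint B x & B y]) A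
  (fun x y => congr1 negb (disjoint_sym _ _)).
have disN : {in N &, forall x y, x != y -> [disjoint B x & B y]}.
  by move=> x y xN yN xy; have := indN x y xN yN xy; rewrite negbK.
pose large := [set n in N | w < #|B n|]%N.
pose closed := [set n in N | (#|B n| <= w)%N &&
  [forall a in B n, #|detoured A P a| <= beta]%N].
have large_w : (#|large| * w <= #|A|)%N.
  apply: (@leq_trans (\sum_(n in large) #|B n|)).
    rewrite -sum_nat_const; apply: leq_sum => n; rewrite inE => /andP[_].
    exact: ltnW.
  apply: leq_sum_disjoint.
    by move=> n; rewrite inE => /andP[nN _]; apply: ball_sub; apply: (fintype.subsetP NA).
  move=> n m; rewrite !inE => /andP[nN _] /andP[mN _]; exact: disN.
have closed_w : (#|closed| * w <= 2 * #|A|)%N.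
  have closedN : closed \subset N by apply/fintype.subsetP => n; rewrite inE => /andP[].
  have := @card_closed_centers G A P closed w beta nus P0
    (fintype.subset_trans closedN NA).
  case/(_ _ _ small)/wrap.
  - by move=> x y /(fintype.subsetP closedN) xN /(fintype.subsetP closedN) yN; apply: disN.
  - by move=> n; rewrite inE => /and3P[_ ? /forall_inP].
  move=> sq; have mA : (#|closed| <= #|A|)%N.
    exact: subset_leq_card (fintype.subset_trans closedN NA).
  (* With [m] closed centres and [k = #|A|], multiplying [sq] by [w ^ 2] and using
     [beta * w ^ 2 <= k] and [m <= k] bounds [(m * w) ^ 2] by [3 * k ^ 2], whereas [lt] makes it
     exceed [4 * k ^ 2]. *)
  rewrite leqNgt; apply/negP => lt.
  move: (#|closed|) (#|A|) sq mA lt betaA A0 => m k sq mA lt betaA A0.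
  have := leq_mul sq (leqnn (w ^ 2)); rewrite -expnMn.
  have := leq_mul lt lt; have : (0 < w ^ 2)%N by rewrite expn_gt0 w0.
  clearbody beta; move: (w ^ 2)%N betaA => W betaA W0.
  have : (0 < W * beta)%N by rewrite muln_gt0 W0.
  nia.
pose D := D1 :|: D2 :|: large :|: closed.
exists D; split.
  have cD : (#|D| <= #|D1| + #|D2| + #|large| + #|closed|)%N.
    apply: leq_trans (leq_card_setU _ _) _; rewrite leq_add2r.
    apply: leq_trans (leq_card_setU _ _) _; rewrite leq_add2r.
    exact: leq_card_setU.
  apply: leq_trans (leq_mul cD (leqnn w)) _; rewrite !mulnDl.
  apply: leq_trans (leq_add (leq_add (leq_add D1w D2w) large_w) closed_w) _.
  by move: (#|A|) => k; lia.
have D1D : D1 \subset D by rewrite /D -!finset.setUA finset.subsetUl.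
have D2D : D2 \subset D.
  by apply/fintype.subsetP => x xD; rewrite !inE xD !orbT.
have PD h : h \in P -> spans D 2 h by move/D2P; apply: spans_subset.
have near x y : y \in B x -> spans D (w * 2) (y - x) by apply: ball_spans.
move=> a aA; have [n nN an] := domN a aA.
have [y ya yn] : exists2 y, y \in B a & y \in B n.
  case/orP: an => [/eqP <-|/pred0Pn[y /andP[]]]; last by exists y.
  by exists a; apply: ball_center.
suff spans_n : spans D (2 * w + 3) n.
  rewrite (_ : a = n + (y - n) - (y - a)); last first.
    by rewrite [n + _]addrC subrK opprB addrC subrK.
  apply: (@spans_le _ _ ((2 * w + 3 + w * 2) + w * 2)); first by clear; lia.
  exact: spansD (spansD spans_n (near _ _ yn)) (spansN (near _ _ ya)).
have [nD|nD] := boolP (n \in D); first by apply: spans_le (spans_mem nD); rewrite addn3.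
(* A centre outside [D] is neither large nor closed, so its ball contains some [g] with many
   detours. *)
move: nD; rewrite !inE nN /= !negb_or => /andP[/andP[_ nlarge]].
rewrite -leqNgt in nlarge; rewrite nlarge /= negb_forall_in => /exists_inP[g gn].
rewrite -ltnNge => /ltnW gbig.
have gA : g \in A by apply: (fintype.subsetP (ball_sub P w (fintype.subsetP NA _ nN))).
have sg : spans D 3 g.
  by apply: spans_subset D1D _; apply: D1P => //; rewrite mulnA -/t.
rewrite (_ : n = g - (g - n)); last by rewrite opprB addrC subrK.
apply: (@spans_le _ _ (3 + w * 2)); first by clear; lia.
exact: spansD sg (spansN (near _ _ gn)).
Qed.

(** * The choice of parameters *)

(** A unique ordered pair in [A], [A] equals its swap, so it is a doubled element whose sum is
    unique. *)
Lemma least_pdiv_le_spans (G : finZmodType) (A D : {set G}) (M : nat) :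
  no_unique_sum A -> (0 < #|A|)%N -> (0 < M)%N ->
  (forall a, a \in A -> spans D M a) -> (least_pdiv G <= (4 * M) ^ #|D|)%N.
Proof.
move=> nus A0 M0 AD; rewrite leqNgt; apply/negP => small.
have [a [b [aA bA uab]]] := span_unique_pair M0 AD small
  (fintype.subxx A) (fintype.subxx A) A0 A0.
have [ba _] := uab b a bA aA (addrC a b); rewrite -{}ba in aA uab *.
move/forall_inP: nus => /(_ b bA)/forall_inP/(_ b bA)/exists_inP[c cA /exists_inP[d dA]].
by case/andP => /eqP /(uab c d cA dA)[-> ->]; rewrite !eqxx.
Qed.

(** Tailored to [w = v ^ 2] and [s = 6 * v]: then [t = 6 * v ^ 7], [beta] is at most [666 * v ^ 14],
    and [beta * w ^ 2] is below [2 ^ 10 * v ^ 18]. *)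
Lemma poly_le_exp2 (v : nat) : (2 ^ 8 <= v)%N -> (2 ^ 10 * v ^ 18 <= 2 ^ v.-1)%N.
Proof.
move=> v8; have v0 : (0 < v)%N by apply: leq_trans v8.
have [lo hi] := andP (trunc_log_bounds (isT : 1 < 2)%N v0).
set j := trunc_log 2 v in lo hi.
have j8 : (8 <= j)%N by rewrite -ltnS -(ltn_exp2l _ _ (isT : 1 < 2)%N) (leq_ltn_trans v8).
have jle : (18 * j + 29 <= 2 ^ j)%N.
  move: (j) j8; elim=> // i IH; rewrite leq_eqVlt => /predU1P[<- //|/IH le_i].
  by rewrite expnS; lia.
apply: (@leq_trans (2 ^ 10 * (2 ^ j.+1) ^ 18)).
  by rewrite leq_mul2l leq_exp2r // ltnW.
by rewrite -expnM -expnD leq_exp2l //; lia.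
Qed.

(** [A] spans itself with [M = 1], so [least_pdiv G] is at most [4 ^ #|A|]. *)
Lemma card_no_unique_sum_log (G : finZmodType) (A : {set G}) (n : nat) :
  no_unique_sum A -> (0 < #|A|)%N -> (2 ^ n <= least_pdiv G)%N -> (n <= 2 * #|A|)%N.
Proof.
move=> nus A0 nG; rewrite -(leq_exp2l _ _ (isT : 1 < 2)%N); apply: leq_trans nG _.
by rewrite expnM; apply: (least_pdiv_le_spans (M := 1) nus) => // a; apply: spans_mem.
Qed.

(** Here [n] and [v] play the roles of the binary logarithms of [least_pdiv G] and of [n]. Arguing
    by contradiction supplies the upper bound on [#|A|] that random hitting asks for. *)
Lemma card_no_unique_sum_loglog (G : finZmodType) (A : {set G}) (n v : nat) :
  no_unique_sum A -> (0 < #|A|)%N -> (2 ^ n <= least_pdiv G)%N ->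
  (2 ^ v <= n < 2 ^ v.+1)%N -> (2 ^ 8 <= v)%N -> (n * v <= 5 * #|A|)%N.
Proof.
move=> nus A0 nG /andP[vn nv] v8.
have v0 : (0 < v)%N by apply: leq_trans v8.
have pv := poly_le_exp2 v8.
have nk := card_no_unique_sum_log nus A0 nG.
rewrite leqNgt; apply/negP => ltk.
have vE : (2 ^ v = 2 * 2 ^ v.-1)%N by rewrite -expnS prednK.
have v2 : (36 * v ^ 2 <= 2 ^ v)%N.
  apply: leq_trans (_ : 2 ^ 10 * v ^ 18 <= _)%N; first by rewrite leq_mul // leq_pexp2l.
  by rewrite vE; apply: leq_trans pv _; rewrite leq_pmull.
have w1 : (v ^ 2 <= 2 ^ v)%N by apply: leq_trans v2; rewrite leq_pmull.
have w0 : (0 < v ^ 2)%N by rewrite expn_gt0 v0.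
have [||||D [cardD spanD]] := @ex_small_basis G A (v ^ 2) (6 * v) nus w0.
- by rewrite muln_gt0.
- have kle : (#|A| < 2 ^ (2 * v + 1))%N.
    have : (n * v <= 2 ^ v.+1 * 2 ^ v)%N by apply: leq_mul; rewrite ltnW // ltn_expl.
    by rewrite -expnD (_ : v.+1 + v = 2 * v + 1)%N; clear -ltk; lia.
  have k2 : (#|A| ^ 2 < 2 ^ (4 * v + 2))%N.
    by rewrite (_ : 4 * v + 2 = (2 * v + 1) * 2)%N ?expnM ?ltn_exp2r //; clear; lia.
  apply: (@leq_ltn_trans (2 ^ v * #|A| ^ 2)).
    by rewrite leq_mul2r w1 orbT.
  apply: (@leq_trans (2 ^ v * 2 ^ (4 * v + 2))).
    by rewrite ltn_pmul2l // expn_gt0.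
  rewrite -expnD leq_exp2l //; clear -v8.
  by move: (leq_trans (isT : 2 <= 2 ^ 8)%N v8); clear; lia.
- apply: (@leq_trans (2 ^ v.-1)); last first.
    by rewrite -(leq_pmul2l (isT : 0 < 2)%N) -vE; apply: leq_trans nk.
  apply: leq_trans pv; rewrite -!expnM.
  have -> : (v ^ (2 * 3) * (6 * v) = 6 * v ^ 7)%N by rewrite mulnCA -expnSr.
  rewrite -[(2 * 2)%N]/4%N (expnD v 14 4) [leqRHS]mulnA leq_mul2r; apply/orP; right.
  rewrite (expnD v 7 7).
  have : (0 < v ^ 7)%N by rewrite expn_gt0 v0.
  move: (v ^ 7)%N => V; clear; nia.
- apply: leq_trans nG; rewrite (_ : 4 = 2 ^ 2)%N // -expnM ltn_exp2l //.
  rewrite mulnA; apply: leq_trans vn; apply: leq_trans v2.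
  by rewrite ltn_pmul2r.
move: spanD => /(least_pdiv_le_spans nus A0) => /(_ _)/wrap[|qle]; first by rewrite addn3.
(* The base [4 * (6 * w + 3)] is at most [36 * v ^ 2], hence at most [2 ^ v]. *)
have : (2 ^ n <= 2 ^ (v * #|D|))%N.
  apply: leq_trans nG _; apply: leq_trans qle _; rewrite expnM.
  case: (posnP #|D|) => [->|D0]; first by rewrite !expn0.
  rewrite leq_exp2r //; apply: leq_trans v2; move: (v ^ 2)%N w0; clear; lia.
rewrite leq_exp2l // => nle; move: ltk; rewrite ltnNge; apply/negP/negPn.
apply: leq_trans cardD; rewrite -mulnn [leqRHS]mulnA [(#|D| * v)%N]mulnC.
by rewrite leq_mul2r nle orbT.
Qed.

(** * Passage to natural logarithms *)

(** This uses [ln 2 <= 1]; for [x <= 0] the convention [ln x = 0] applies. *)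
Lemma ln_le_exp2 (R : realType) (x : R) (m : nat) : x <= 2 ^+ m -> ln x <= m%:R.
Proof.
move=> xm; have [x0|x0] := lerP x 0; first by rewrite ln0.
apply: le_trans (_ : ln (2 ^+ m) <= _); first by rewrite ler_ln ?posrE ?exprn_gt0.
rewrite lnXn //; apply: ler_wMn2r.
by apply: (@le_ln1Dx R 1); lra.
Qed.

Lemma cstar_bounds (R : realType) : 0 < cstar R /\ cstar R <= 640^-1.
Proof.
have sum0 : 0 <= 40 * 10 ^+ 18 + 10 * 10 ^+ 9 + 6 * 10 ^+ 6 + 48 * 10 ^+ 3 :> R.
  by rewrite !addr_ge0 // mulr_ge0 ?exprn_ge0.
rewrite /cstar; move: (_ + 48 * 10 ^+ 3) sum0 => x x0.
have lex : 640 <= x + 640 by rewrite lerDr.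
have p640 : 0 < 640 :> R by rewrite ltr0n.
have x640 := lt_le_trans p640 lex.
by rewrite invr_gt0 lef_pV2 ?posrE.
Qed.

Lemma card_no_unique_sum_ln (R : realType) (G : finZmodType) (A : {set G}) :
  (2 < least_pdiv G)%N -> (2 <= #|A|)%N -> no_unique_sum A ->
  cstar R * ln (least_pdiv G)%:R * ln (ln (least_pdiv G)%:R) <= #|A|%:R.
Proof.
move=> q2 A2 nus; set q := least_pdiv G in q2 *.
have A0 : (0 < #|A|)%N by apply: ltnW.
have q0 : (0 < q)%N by apply: ltnW (ltnW _).
have /andP[qlo qhi] := trunc_log_bounds (isT : 1 < 2)%N q0.
set n := trunc_log 2 q in qlo qhi.
have n0 : (0 < n)%N.
  by rewrite lt0n; apply: contraTneq qhi => ->; rewrite -leqNgt expn1 ltnW.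
have /andP[nlo nhi] := trunc_log_bounds (isT : 1 < 2)%N n0.
set v := trunc_log 2 n in nlo nhi.
(* If [v < 256], then [n <= 2 * #|A|] bounds the product by [512 * #|A| + 256], at most [640 * #|A|]
   because [#|A| >= 2]. Otherwise it is at most [4 * n * v], hence at most [20 * #|A|]. *)
have nv : (n.+1 * v.+1 <= 640 * #|A|)%N.
  have nk := card_no_unique_sum_log nus A0 qlo.
  have [v8|v8] := leqP (2 ^ 8) v; last first.
    apply: leq_trans (leq_mul (leqnn _) v8) _; rewrite (_ : 2 ^ 8 = 256)%N //; lia.
  have nlv : (2 ^ v <= n < 2 ^ v.+1)%N by rewrite nlo.
  have := card_no_unique_sum_loglog nus A0 qlo nlv v8.
  have : (0 < v)%N by apply: leq_trans v8.
  move: n0; clear; nia.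
have nvR : 640^-1 * n.+1%:R * v.+1%:R <= #|A|%:R :> R.
  move: nv; move: 640%N (isT : 0 < 640)%N => C C0 nv.
  by rewrite -mulrA ler_pdivrMl ?ltr0n // -!natrM ler_nat.
have lnq : ln (q%:R : R) <= n.+1%:R.
  by apply: ln_le_exp2; rewrite -natrX ler_nat ltnW.
have lnlnq : ln (ln (q%:R : R)) <= v.+1%:R.
  by apply: ln_le_exp2; apply: le_trans lnq _; rewrite -natrX ler_nat.
have lnq0 : 0 <= ln (q%:R : R) by rewrite ln_ge0 // ler1n.
have [c0 c640] := cstar_bounds R; have {c0} := ltW c0.
move: (cstar R) c640 => c c640 c0.
(* Replacing [ln (ln q)] first requires only that [c * ln q] be nonnegative. *)
apply: le_trans (_ : c * ln q%:R * v.+1%:R <= _).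
  by rewrite ler_wpM2l // mulr_ge0.
by apply: le_trans nvR; rewrite ler_wpM2r // ler_pM.
Qed.

Theorem theorem1p2 (R : realType) :
  (forall G : finZmodType, (2 < least_pdiv G)%N ->
     forall A : {set G}, (2 <= #|A|)%N -> no_unique_sum A ->
       cstar R * ln (least_pdiv G)%:R * ln (ln (least_pdiv G)%:R)
         <= #|A|%:R)
  /\
  (exists c : R, 0 < c /\ exists q0 : nat,
     forall G : finZmodType, (q0 <= least_pdiv G)%N ->
       c * ln (least_pdiv G)%:R * ln (ln (least_pdiv G)%:R)
         <= (min_nus G)%:R).
Proof.
split=> [G q2 A|]; first exact: card_no_unique_sum_ln.
exists (cstar R); split; first by have [] := cstar_bounds R.
(* From 3 on, [#|G| >= 3], so [min_nus G] is attained by an admissible set. *)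
exists 3 => G q3; have G3 : (3 <= #|G|)%N.
  apply: leq_trans q3 _; apply: pdiv_leq.
  by apply/card_gt0P; exists 0.
have [A /andP[A2 nus] <-] := min_nus_attained G3.
exact: card_no_unique_sum_ln.
Qed.
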